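(* Let $y\in F(\mathcal D(F))$, let $(y^\delta)_{\delta>0}\subseteq Y$ be a family of noisy data with $\mathcal S(y,y^\delta)\le\delta$ for all $\delta>0$, set $y^0:=y$, and let $(\hat x^\delta)_{\delta>0}\subseteq\mathcal D(F)$ be a family of regularized approximations. Assume that conditions (i)--(iv), (A), (B) of the context hold (for all $\delta\ge0$), that $$\exists C>0\ \forall\delta>0:\ \mathcal R(\hat x^\delta)\le C, \qquad (1)$$ and that $$\mathcal S(F(\hat x^\delta),y^\delta)\to0\quad\text{as }\delta\to0 .$$ Then for any sequence $\delta_n>0$ with $\delta_n\to0$, the sequence $(\hat x^{\delta_n})$ has a $\mathcal T_X$-convergent subsequence whose limit solves $F(x)=y$. If the solution $x^\dagger$ of $F(x)=y$ is unique, then $\hat x^\delta\to x^\dagger$ in $\mathcal T_X$ as $\delta\to0$. Moreover, if (1) holds with $C=\mathcal R(x^\dagger)$, where $x^\dagger$ is an $\mathcal R$-minimizing solution of $F(x)=y$, then $$\mathcal R(\hat x^\delta)\to\mathcal R(x^\dagger)\quad\text{as }\delta\to0 .$$ Thus, in this case, if in addition $\mathcal R$ is the norm of a space $X$ satisfying the Kadets--Klee property and $\mathcal T_X$ is the weak topology on $X$, the subsequential convergence above (respectively the convergence of the whole family, if the solution is unique) even holds in norm.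
   Context: Setting: $(X,\mathcal T_X)$, $(Y,\mathcal T_Y)$ are topological spaces, $F:\mathcal D(F)\subseteq X\to Y$, and $\mathcal R:X\to[0,\infty]$, $\mathcal S:Y\times Y\to[0,\infty]$ are functionals. An $\mathcal R$-minimizing solution of $F(x)=y$ is an element of $\mathcal D(F)$ minimizing $\mathcal R$ among all solutions. A normed space has the Kadets--Klee property if weak convergence $x_n\rightharpoonup x$ together with $\|x_n\|\to\|x\|$ implies $\|x_n-x\|\to0$. Conditions: (i) $F$ is $\mathcal T_X$-$\mathcal T_Y$-sequentially closed: if $(x_n)\subseteq\mathcal D(F)$, $x_n\to x$ in $\mathcal T_X$ and $F(x_n)\to z$ in $\mathcal T_Y$, then $x\in\mathcal D(F)$ and $F(x)=z$. (ii) $\mathcal R$ and $\mathcal S(\cdot,y^\delta)$ are lower semicontinuous with respect to $\mathcal T_X$ and $\mathcal T_Y$, respectively. (iii) For any $C>0$ the set $\{x\in\mathcal D(F):\mathcal R(x)\le C\}$ is $\mathcal T_X$-compact. (iv) For any $C>0$ and any $y^\delta\in Y$ the set $\{z\in F(\mathcal D(F)):\mathcal S(z,y^\delta)\le C\}$ is $\mathcal T_Y$-compact. Compactness is understood sequentially: every sequence in the set has a convergent subsequence with limit in the set. (A) For any two sequences $(y_n)$, $(\tilde y_n)$ in $Y$: if $\mathcal S(y_n,\tilde y_n)\to0$ and $\mathcal S(y,\tilde y_n)\to0$ as $n\to\infty$, then $\mathcal S(y_n,y)\to0$. (B) $\mathcal S(\tilde y,y)=0$ implies $\tilde y=y$.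 *)

(* Defs.v *)
From mathcomp Require Import all_boot all_order all_algebra.
From mathcomp Require Import all_classical all_reals all_analysis.
Set Implicit Arguments.
Unset Strict Implicit.
Unset Printing Implicit Defensive.
Import Order.TTheory GRing.Theory Num.Theory.
Import numFieldNormedType.Exports.
Local Open Scope classical_set_scope.
Local Open Scope ring_scope.

Definition seq_compact (X : topologicalType) (A : set X) : Prop :=
  forall u : nat -> X, (forall n, A (u n)) ->
    exists phi : nat -> nat, exists x : X,
      [/\ increasing_seq phi, A x & u (phi n) @[n --> \oo] --> x].

(* A partial operator with domain [D] is a total function [F] of which only
   the values on [D] are ever used. *)
Definition seq_closed_operator (X Y : topologicalType)
    (D : set X) (F : X -> Y) : Prop :=
  forall (u : nat -> X) (x : X) (z : Y), (forall n, D (u n)) ->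
    u n @[n --> \oo] --> x -> F (u n) @[n --> \oo] --> z -> D x /\ F x = z.

Definition solution (X Y : Type) (D : set X) (F : X -> Y) (y : Y) : set X :=
  [set x | D x /\ F x = y].

Definition unique_solution (X Y : Type) (D : set X) (F : X -> Y) (y : Y)
    (x : X) : Prop :=
  solution D F y x /\ forall x', solution D F y x' -> x' = x.

Definition minimizing_solution (R : realType) (X Y : Type)
    (D : set X) (F : X -> Y) (Rf : X -> \bar R) (y : Y) (x : X) : Prop :=
  solution D F y x /\ forall x', solution D F y x' -> (Rf x <= Rf x')%E.

(* [yd d] for [d > 0] is the noisy data with noise level [d], [yd 0] is the
   exact data [y], and [xh d] for [d > 0] is the regularized approximation;
   the values of [yd] and [xh] at other [d] are never used. *)
Record regularization_setting (R : realType) (X Y : topologicalType)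
    (D : set X) (F : X -> Y) (Rf : X -> \bar R) (S : Y -> Y -> \bar R)
    (y : Y) (yd : R -> Y) (xh : R -> X) : Prop := RegularizationSetting {
  Rf_ge0 : forall x, (0 <= Rf x)%E ;
  S_ge0 : forall z z', (0 <= S z z')%E ;
  exact_data : (F @` D) y ;
  noise_level : forall d, 0 < d -> (S y (yd d) <= d%:E)%E ;
  yd0 : yd 0 = y ;
  xh_dom : forall d, 0 < d -> D (xh d) ;
  F_closed : seq_closed_operator D F ;
  Rf_lsc : lower_semicontinuous Rf ;
  S_lsc : forall d, 0 <= d -> lower_semicontinuous (fun z => S z (yd d)) ;
  Rf_compact : forall C : R, 0 < C ->
    seq_compact [set x | D x /\ (Rf x <= C%:E)%E] ;
  S_compact : forall (C : R) (y' : Y), 0 < C ->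
    seq_compact [set z | (F @` D) z /\ (S z y' <= C%:E)%E] ;
  S_triangle : forall yn yn' : nat -> Y,
    S (yn n) (yn' n) @[n --> \oo] --> 0%E ->
    S y (yn' n) @[n --> \oo] --> 0%E ->
    S (yn n) y @[n --> \oo] --> 0%E ;
  S_separated : forall y', S y' y = 0%E -> y' = y ;
  xh_bounded : exists2 C : R, 0 < C &
    forall d, 0 < d -> (Rf (xh d) <= C%:E)%E ;
  residual_cvg : S (F (xh d)) (yd d) @[d --> 0^'+] --> 0%E
}.

(* [V] with its weak topology: the coarsest topology for which all norm
   continuous linear functionals are continuous. *)
Definition weak_topology_family (R : realType) (V : normedModType R)
    (f : {f : {linear V -> R^o} | continuous f}) : Topological V :=
  Topological.on (initial_topology (sval f : V -> R^o)).

Definition weak_space (R : realType) (V : normedModType R) : topologicalType :=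
  sup_topology (@weak_topology_family R V).

Definition kadets_klee (R : realType) (V : normedModType R) : Prop :=
  forall (u : nat -> V) (x : V),
    (u n : weak_space V) @[n --> \oo] --> (x : weak_space V) ->
    `|u n| @[n --> \oo] --> `|x| ->
    `|u n - x| @[n --> \oo] --> 0.

(* Main.v *)
Require Import Defs.
From mathcomp Require Import all_boot all_order all_algebra.
From mathcomp Require Import all_classical all_reals all_analysis.
Set Implicit Arguments.
Unset Strict Implicit.
Unset Printing Implicit Defensive.
Import Order.TTheory GRing.Theory Num.Theory.
Import numFieldNormedType.Exports.
Local Open Scope classical_set_scope.
Local Open Scope ring_scope.

(** The proof is a compactness argument. Along [dn] tending to [0], the bound on
    [Rf] places the approximations [xh (dn n)] in a sequentially compact sublevel
    set, so that a subsequence converges; it remains to recognize its limit as a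
    solution. The residuals vanish, first with respect to the noisy data and
    then, by condition (A), with respect to the exact data
    ([image_residual_cvg]); compactness of the sublevel sets of [S^~ y] then
    makes the images converge along a further subsequence, necessarily to [y],
    and closedness of [F] makes the limit a solution ([limit_is_solution]).

    The statements on the whole family follow from the resulting principle
    [near_of_solutions]: an event occurs for all small [d] as soon as it occurs
    along every sequence that converges to a solution. If the solution is unique,
    this is convergence of the family. If [Rf (xh d) <= Rf xd] with [xd] an
    [Rf]-minimizing solution, all solutions have at least the value [Rf xd], and
    lower semicontinuity prevents [Rf (xh d)] from staying below it.

    In a normed space with its weak topology, the last point says that
    [`|xh d|] tends to [`|xd|], which is also the norm of every weak limit; the
    Kadets--Klee property upgrades weak convergence along a sequence to norm
    convergence ([weak_to_norm_cvg]). *)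

(** * Sequences and one-sided neighbourhoods *)

Lemma increasing_seq_cvg_infty (phi : nat -> nat) :
  increasing_seq phi -> phi n @[n --> \oo] --> \oo.
Proof.
move=> phi_incr A [N _ NA]; exists N => // n /= Nn; apply: NA => /=.
apply: (leq_trans Nn); elim: n {Nn} => // n IHn.
by apply: (leq_ltn_trans IHn); move/increasing_seqP: phi_incr; apply.
Qed.

Lemma cvg_seq_at_right (R : realType) (p : R) (u : nat -> R) :
  (forall n, p < u n) -> u n @[n --> \oo] --> p -> u n @[n --> \oo] --> p^'+.
Proof.
move=> pu /cvgrPdist_lt u_cvg U /= [e e0 eU].
by apply: filterS (u_cvg _ e0) => n ne; exact: eU.
Qed.

(** A one-sided neighbourhood property can be tested along sequences. Hitting
    the property a single time along each sequence is enough: were it to fail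
    arbitrarily close to the point, a sequence of failures would never hit it.
    It is this weak form that lets subsequence extraction prove convergence of
    a whole family. *)
Lemma near_at_right_seq (R : realType) (p : R) (P : set R) :
  (forall u : nat -> R, (forall n, p < u n) -> u n @[n --> \oo] --> p ->
    exists n, P (u n)) ->
  \forall d \near p^'+, P d.
Proof.
move=> Pseq; apply: contrapT => notP.
have : ~ (\forall d \near p^'+, [pred d | `[< P d >]] d).
  apply: contra_not notP; apply: filterS => d /= Pd; exact/asboolP.
move/not_near_at_rightP => bad.
have invn_gt0 n : 0 < n.+1%:R^-1 :> R by rewrite invr_gt0.
have /choice[u u_bad] n : exists d, [/\ p < d, d < p + n.+1%:R^-1 & ~ P d].
  have [d /andP[pd dn] NPd] := bad (PosNum (invn_gt0 n)).
  by exists d; split=> // Pd; apply: NPd; exact/asboolP.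
suff u_cvg : u n @[n --> \oo] --> p.
  have u_gt n : p < u n by have [] := u_bad n.
  by have [n] := Pseq u u_gt u_cvg; have [] := u_bad n.
apply: (@squeeze_cvgr _ _ _ _ (cst p) (fun n => p + n.+1%:R^-1)).
- by apply: nearW => n; have [/ltW -> /ltW ->] := u_bad n.
- exact: cvg_cst.
- rewrite -[X in _ --> X]addr0; apply: cvgD; first exact: cvg_cst.
  exact: cvg_harmonic.
Qed.

(** * Lower semicontinuity along filters *)

Section lower_semicontinuity.
Context {R : realType}.

Lemma lsc_near_gt (X : topologicalType) (f : X -> \bar R) (I : Type)
    (G : set_system I) {FG : Filter G} (u : I -> X) (x : X) (a : R) :
  lower_semicontinuous f -> u i @[i --> G] --> x -> (a%:E < f x)%E ->
  \forall i \near G, (a%:E < f (u i))%E.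
Proof.
move=> f_lsc ux /f_lsc[U xU Uf].
have uU : \forall i \near G, U (u i) := ux _ xU.
by apply: filterS uU => i; exact: Uf.
Qed.

Lemma lsc_le_lim (X : topologicalType) (f : X -> \bar R) (I : Type)
    (G : set_system I) {FG : ProperFilter G} (u : I -> X) (x : X) (c : R) :
  lower_semicontinuous f -> u i @[i --> G] --> x ->
  (\forall i \near G, (f (u i) <= c%:E)%E) -> (f x <= c%:E)%E.
Proof.
move=> f_lsc ux fuc; rewrite leNgt; apply/negP => cfx.
have [i [+ cfu]] := filter_ex (filterI fuc (lsc_near_gt f_lsc ux cfx)).
by rewrite leNgt cfu.
Qed.

(** With an upper bound by the limit for free, convergence only asks for the
    lower half of the neighbourhoods; this is the half that lower
    semicontinuity provides. *)
Lemma cvge_lower (I : Type) (G : set_system I) {FG : Filter G}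
    (f : I -> \bar R) (l : \bar R) :
  (\forall i \near G, (f i <= l)%E) ->
  (forall a : R, (a%:E < l)%E -> \forall i \near G, (a%:E < f i)%E) ->
  f i @[i --> G] --> l.
Proof.
case: l => [l| |] f_le f_gt.
- have f_gtB e : 0 < e -> \forall i \near G, ((l - e)%:E < f i)%E.
    by move=> e0; apply: f_gt; rewrite lte_fin ltrBlDr ltrDl.
  have f_fin : \forall i \near G, f i \is a fin_num.
    move: f_le (f_gtB _ ltr01); apply: filterS2 => i fl lf.
    by rewrite fin_numElt (lt_trans (ltNyr _) lf) (le_lt_trans fl (ltry _)).
  apply: cvg_EFin => //; apply/cvgrPdist_lt => e e0.
  move: f_fin f_le (f_gtB _ e0); apply: filterS3 => i /= /fineK <-.
  rewrite lee_fin lte_fin /= => fl lf; rewrite ger0_norm ?subr_ge0//.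
  by rewrite ltrBlDr addrC -ltrBlDr.
- by apply/cvgeyPgt => a; exact: f_gt (ltry a).
- apply/cvgeNyPle => a; move: f_le; apply: filterS => i.
  by rewrite leeNy_eq => /eqP ->; exact: leNye.
Qed.

End lower_semicontinuity.

(** * Convergence in a topological space *)

Section convergence.
Context {R : realType} {X Y : topologicalType}.
Variables (D : set X) (F : X -> Y) (Rf : X -> \bar R) (S : Y -> Y -> \bar R).
Variables (y : Y) (yd : R -> Y) (xh : R -> X).
Hypothesis reg : regularization_setting D F Rf S y yd xh.

(** The residual tends to [0] with respect to the noisy data, and so does the
    distance from [y] to the noisy data; condition (A), the substitute for a
    triangle inequality, transfers this to the exact data. *)
Lemma image_residual_cvg (dn : nat -> R) :
  (forall n, 0 < dn n) -> dn n @[n --> \oo] --> 0 ->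
  S (F (xh (dn n))) y @[n --> \oo] --> 0%E.
Proof.
move=> dn0 dn_cvg; apply: (S_triangle reg (yn' := fun n => yd (dn n))).
- exact: cvg_comp (cvg_seq_at_right dn0 dn_cvg) (residual_cvg reg).
- apply: (@squeeze_cvge _ _ _ _ (cst 0%E) _ (fun n => (dn n)%:E)).
  + apply: nearW => n; rewrite (S_ge0 reg)/=.
    exact: noise_level reg _ (dn0 n).
  + exact: cvg_cst.
  + by apply: cvg_EFin => //; exact: nearW.
Qed.

(** The images need not converge a priori. Compactness of a sublevel set of
    [S^~ y] makes a subsequence of them converge to some [z], lower
    semicontinuity gives [S z y = 0], hence [z = y] by separation, and
    closedness of [F] along that subsequence concludes: the subsequence of [u]
    keeps the same limit [x]. *)
Lemma limit_is_solution (u : nat -> X) (x : X) :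
  (forall n, D (u n)) -> u n @[n --> \oo] --> x ->
  S (F (u n)) y @[n --> \oo] --> 0%E -> solution D F y x.
Proof.
move=> Du ux Su.
have Su_le e : 0 < e -> \forall n \near \oo, (S (F (u n)) y <= e%:E)%E.
  move=> e0; have [S_fin /cvgrPdist_lt/(_ _ e0) S_lt] := (fine_cvgP _ _).1 Su.
  move: S_fin S_lt; apply: filterS2 => n /= /fineK <-.
  rewrite sub0r normrN lee_fin => /ltW; apply: le_trans; exact: ler_norm.
(* Only a tail is known to lie in the sublevel set, so the extraction is
   made from the shifted sequence. *)
have [N _ SN] := Su_le 1 ltr01.
have [|phi [z [phi_incr [_ _] z_cvg]]] :=
  S_compact reg (C := 1) (y' := y) ltr01 (u := fun n => F (u (n + N)%N)).
  move=> n; split; first by exists (u (n + N)%N).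
  by apply: SN => /=; exact: leq_addl.
have sub_cvg : (phi n + N)%N @[n --> \oo] --> \oo.
  exact: cvg_comp (increasing_seq_cvg_infty phi_incr) (cvg_addnr N).
have S0 : S z y = 0%E.
  apply/eqP; rewrite eq_le (S_ge0 reg) andbT; apply/lee_addgt0Pr => e e0.
  rewrite add0e.
  have Sy_lsc : lower_semicontinuous (S^~ y).
    by have := S_lsc reg (lexx 0); rewrite (yd0 reg).
  exact: lsc_le_lim Sy_lsc z_cvg (sub_cvg _ (Su_le e e0)).
have -> : y = z by rewrite (S_separated reg S0).
apply: (F_closed reg (u := fun n => u (phi n + N)%N)) => //.
exact: (cvg_comp _ _ sub_cvg ux).
Qed.

Lemma subseq_cvg_solution (dn : nat -> R) :
  (forall n, 0 < dn n) -> dn n @[n --> \oo] --> 0 ->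
  exists phi : nat -> nat, exists x : X,
    [/\ increasing_seq phi, solution D F y x &
        xh (dn (phi n)) @[n --> \oo] --> x].
Proof.
move=> dn0 dn_cvg; have [C C0 xhC] := xh_bounded reg.
have [n|phi [x [phi_incr _ x_cvg]]] := Rf_compact reg C0 (u := xh \o dn).
  by split; [exact: xh_dom reg _ (dn0 n) | exact: xhC].
exists phi, x; split => //.
apply: limit_is_solution x_cvg _ => [n|]; first exact: xh_dom reg _ (dn0 _).
exact: cvg_comp (increasing_seq_cvg_infty phi_incr)
  (image_residual_cvg dn0 dn_cvg).
Qed.

(** The common principle behind the convergence of the whole family: to enter
    [P] as [d] tends to [0], it suffices that all sequences converging to
    solutions enter [P]. For [P] a neighbourhood of the only solution this is
    convergence of [xh]; for [P] a strict superlevel set of [Rf] it is the lower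
    half of convergence of [Rf \o xh]. *)
Lemma near_of_solutions (P : set X) :
  (forall (x : X) (u : nat -> X), solution D F y x -> u n @[n --> \oo] --> x ->
    \forall n \near \oo, P (u n)) ->
  \forall d \near 0^'+, P (xh d).
Proof.
move=> Psol; apply: near_at_right_seq => u u0 u_cvg.
have [phi [x [_ x_sol x_cvg]]] := subseq_cvg_solution u0 u_cvg.
by have /filter_ex[n Pn] := Psol x _ x_sol x_cvg; exists (phi n).
Qed.

Lemma cvg_unique_solution (xd : X) :
  unique_solution D F y xd -> xh d @[d --> 0^'+] --> xd.
Proof.
move=> [_ xd_uniq] U xdU; apply: near_of_solutions => x u /xd_uniq ->.
exact.
Qed.

(** If [a < Rf xd], then every solution [x] has [a < Rf x] by minimality of
    [xd], so by lower semicontinuity [a < Rf] holds along any sequence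
    converging to [x]. *)
Lemma functional_cvg (xd : X) :
  minimizing_solution D F Rf y xd ->
  (forall d : R, 0 < d -> (Rf (xh d) <= Rf xd)%E) ->
  Rf (xh d) @[d --> 0^'+] --> Rf xd.
Proof.
move=> [_ xd_min] xh_le; apply: cvge_lower.
  by near=> d; apply: xh_le; near: d; exact: nbhs_right_gt.
move=> a axd; apply: (near_of_solutions (P := [set x | (a%:E < Rf x)%E])).
move=> x u x_sol ux.
exact: lsc_near_gt (Rf_lsc reg) ux (lt_le_trans axd (xd_min _ x_sol)).
Unshelve. all: by end_near. Qed.

End convergence.

(** * From weak to norm convergence *)

Section kadets_klee_convergence.
Context {R : realType} {V : normedModType R} {Y : topologicalType}.
Variables (D : set V) (F : V -> Y) (S : Y -> Y -> \bar R).
Variables (y : Y) (yd : R -> Y) (xh : R -> V) (xd : V).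
Hypothesis kkV : kadets_klee V.
Hypothesis reg : @regularization_setting R (weak_space V) Y D F
  (fun x : V => `|x|%:E) S y yd xh.
Hypothesis xd_min : minimizing_solution D F (fun x : V => `|x|%:E) y xd.
Hypothesis xh_le : forall d : R, 0 < d -> `|xh d| <= `|xd|.

(** The weak limit [x] may differ from [xd], but it has the same norm: [<=] by
    weak lower semicontinuity of the norm, [>=] because [x] is a solution.
    Hence [functional_cvg] says that the norms converge to [`|x|], as the
    Kadets--Klee property demands. *)
Lemma weak_to_norm_cvg (dn : nat -> R) (x : V) :
  (forall n, 0 < dn n) -> dn n @[n --> \oo] --> 0 -> solution D F y x ->
  (xh (dn n) : weak_space V) @[n --> \oo] --> (x : weak_space V) ->
  `|xh (dn n) - x| @[n --> \oo] --> 0.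
Proof.
move=> dn0 dn_cvg x_sol x_cvg; apply: kkV => //.
have -> : `|x| = `|xd|.
  apply/eqP; rewrite eq_le; apply/andP; split; last first.
    by rewrite -lee_fin; exact: xd_min.2.
  rewrite -lee_fin.
  apply: lsc_le_lim (Rf_lsc reg) x_cvg _.
  by apply: nearW => n; rewrite lee_fin; exact: xh_le.
have norm_cvg : `|xh d| @[d --> 0^'+] --> `|xd|.
  exact: fine_cvg (functional_cvg reg xd_min xh_le).
exact: cvg_comp (cvg_seq_at_right dn0 dn_cvg) norm_cvg.
Qed.

Lemma subseq_norm_cvg_solution (dn : nat -> R) :
  (forall n, 0 < dn n) -> dn n @[n --> \oo] --> 0 ->
  exists phi : nat -> nat, exists x : V,
    [/\ increasing_seq phi, solution D F y x &
        `|xh (dn (phi n)) - x| @[n --> \oo] --> 0].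
Proof.
move=> dn0 dn_cvg.
have [phi [x [phi_incr x_sol x_cvg]]] := subseq_cvg_solution reg dn0 dn_cvg.
exists phi, x; split => //; have dn_phi_cvg : dn (phi n) @[n --> \oo] --> 0.
  exact: cvg_comp (increasing_seq_cvg_infty phi_incr) dn_cvg.
exact: weak_to_norm_cvg (fun n => dn0 (phi n)) dn_phi_cvg x_sol x_cvg.
Qed.

Lemma norm_cvg_unique_solution (x : V) :
  unique_solution D F y x -> `|xh d - x| @[d --> 0^'+] --> 0.
Proof.
move=> x_uniq; apply/cvg_at_rightP => dn [dn0 dn_cvg].
apply: weak_to_norm_cvg => //; first exact: x_uniq.1.
have x_cvg := cvg_unique_solution reg x_uniq.
exact: cvg_comp (cvg_seq_at_right dn0 dn_cvg) x_cvg.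
Qed.

End kadets_klee_convergence.

(** * Convergence of the regularized approximations *)

Theorem theorem2p5 (R : realType) :
  (forall (X Y : topologicalType) (D : set X) (F : X -> Y)
      (Rf : X -> \bar R) (S : Y -> Y -> \bar R)
      (y : Y) (yd : R -> Y) (xh : R -> X),
    regularization_setting D F Rf S y yd xh ->
    [/\ forall dn : nat -> R, (forall n, 0 < dn n) ->
          dn n @[n --> \oo] --> 0 ->
          exists phi : nat -> nat, exists x : X,
            [/\ increasing_seq phi, solution D F y x &
                xh (dn (phi n)) @[n --> \oo] --> x],
        forall xd : X, unique_solution D F y xd ->
          xh d @[d --> 0^'+] --> xd &
        forall xd : X, minimizing_solution D F Rf y xd ->
          (forall d : R, 0 < d -> (Rf (xh d) <= Rf xd)%E) ->
          Rf (xh d) @[d --> 0^'+] --> Rf xd])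
  /\
  (forall (V : normedModType R) (Y : topologicalType) (D : set V) (F : V -> Y)
      (S : Y -> Y -> \bar R) (y : Y) (yd : R -> Y) (xh : R -> V) (xd : V),
    kadets_klee V ->
    @regularization_setting R (weak_space V) Y D F (fun x : V => `|x|%:E)
      S y yd xh ->
    minimizing_solution D F (fun x : V => `|x|%:E) y xd ->
    (forall d : R, 0 < d -> `|xh d| <= `|xd|) ->
    (forall dn : nat -> R, (forall n, 0 < dn n) ->
      dn n @[n --> \oo] --> 0 ->
      exists phi : nat -> nat, exists x : V,
        [/\ increasing_seq phi, solution D F y x &
            `|xh (dn (phi n)) - x| @[n --> \oo] --> 0])
    /\ (forall x : V, unique_solution D F y x ->
      `|xh d - x| @[d --> 0^'+] --> 0)).
Proof.
split=> [X Y D F Rf S y yd xh reg|V Y D F S y yd xh xd kkV reg xd_min xh_le].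
  split; [exact: subseq_cvg_solution reg | exact: cvg_unique_solution reg |].
  exact: functional_cvg reg.
split; first exact: (subseq_norm_cvg_solution kkV reg xd_min xh_le).
exact: (norm_cvg_unique_solution kkV reg xd_min xh_le).
Qed.
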